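(* Let $f(x)=x^4+ax^2+bx+c\in\mathbb{Z}[x]$ be irreducible with $b$ even and $a,c$ odd (equivalently, $f(x)$ is modulo $2$ the square of an irreducible quadratic polynomial). Let $\theta$ be a root of $f(x)$ in an algebraic closure of $\mathbb{Q}$ and $K=\mathbb{Q}(\theta)$. Then a $2$-integral basis of $K$ is $$1,\ \theta,\ \theta^2,\ \theta^3 \qquad\text{if } \min\{v_2(b+1-a),v_2(c-a)\}=1,$$ and $$1,\ \theta,\ \frac{\theta^2+\theta+1}{2},\ \frac{\theta^3+\theta^2+\theta}{2}\qquad\text{if } \min\{v_2(b+1-a),v_2(c-a)\}>1.$$
   Context: $v_2$ is the $2$-adic valuation, $v_2(0)=\infty$. A $2$-integral basis of $K$ is a family of elements of $K$ that is a $\mathbb{Z}_{(2)}$-basis of $\mathbb{Z}_K\otimes_{\mathbb{Z}}\mathbb{Z}_{(2)}$, where $\mathbb{Z}_K$ is the ring of integers of $K$ and $\mathbb{Z}_{(2)}$ the localization of $\mathbb{Z}$ at $2$. *)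

(* Defs.v *)
(* Mathematical Components; the extended type \bar int of values of the 2-adic
   valuation comes from constructive_ereal. *)
From HB Require Import structures.
From mathcomp Require Import all_boot all_order all_algebra.
From mathcomp Require Import constructive_ereal.

Set Implicit Arguments.
Unset Strict Implicit.
Unset Printing Implicit Defensive.

Import Order.TTheory GRing.Theory Num.Theory.

Local Open Scope ring_scope.

Definition v2 (x : int) : \bar int :=
  if x == 0 then +oo%E else (Posz (logn 2 `|x|%N))%:E.

(* The localization of Z at the prime 2, as a subring of Q; [denq] is the
   denominator in lowest terms. *)
Definition Z_loc2 : {pred rat} := [pred r | odd `|denq r|%N].

Definition quartic (a b c : int) : {poly int} :=
  'X^4 + a *: 'X^2 + b *: 'X + c%:P.

(* [iota] exhibits the field [L] as an extension of Q. *)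
Definition is_algebraic_closure (L : closedFieldType)
    (iota : {rmorphism rat -> L}) : Prop :=
  forall x : L, algebraicOver iota x.

(* The subfield Q(theta) of L. *)
Definition in_Qadjoin (L : closedFieldType) (iota : {rmorphism rat -> L})
    (theta x : L) : Prop :=
  exists p q : {poly rat}, (map_poly iota q).[theta] != 0 /\
    x = (map_poly iota p).[theta] / (map_poly iota q).[theta].

Definition in_ring_of_integers (L : closedFieldType)
    (iota : {rmorphism rat -> L}) (theta x : L) : Prop :=
  in_Qadjoin iota theta x /\ integralOver (intr : int -> L) x.

(* With K = Q(theta), the tensor product of Z_K and Z_(2) over Z is identified
   with its image in K under z (x) r |-> r z, which is injective because K is
   torsion-free: the finite sums of products r z, r in Z_(2) and z in Z_K. *)
Definition in_integers_loc2 (L : closedFieldType)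
    (iota : {rmorphism rat -> L}) (theta x : L) : Prop :=
  exists (m : nat) (r : 'I_m -> rat) (z : 'I_m -> L),
    [/\ forall i, r i \in Z_loc2,
        forall i, in_ring_of_integers iota theta (z i)
      & x = \sum_(i < m) iota (r i) * z i].

(* [B] is a Z_(2)-basis of the above: its entries belong to it, and each of its
   elements is a unique Z_(2)-linear combination of them. *)
Definition is_2integral_basis (L : closedFieldType)
    (iota : {rmorphism rat -> L}) (theta : L) (n : nat) (B : n.-tuple L) : Prop :=
  (forall i, in_integers_loc2 iota theta (tnth B i)) /\
  (forall x, in_integers_loc2 iota theta x ->
     exists! u : 'rV[rat]_n,
       (forall i, u 0 i \in Z_loc2) /\
       x = \sum_(i < n) iota (u 0 i) * tnth B i).

(* Main.v *)
Require Import Defs.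
From HB Require Import structures.
From mathcomp Require Import all_boot all_order all_algebra.
From mathcomp Require Import constructive_ereal ring zify.

Import Order.TTheory GRing.Theory Num.Theory.

Local Open Scope ring_scope.

Set Implicit Arguments.
Unset Strict Implicit.
Unset Printing Implicit Defensive.

(** Put [phi = theta^2 + theta + 1], [d = 1] when the minimum of the valuations
is 1 and [d = 2] when it is larger, and [y = phi / d]. Euclidean division of
[f] by [x^2 + x + 1] gives [phi^2 = (1 - a + 2 theta) phi - (b + 1 - a) theta - (c - a)], so [y] is
a root of a monic quadratic polynomial over [Z[theta]] ([y_sqr]), and the
candidate basis spans the ring [O] with Z-basis [1, theta, y, theta y].

Clearing denominators ([saturated_basis]), a Q-basis of [K] made of integral
elements is a 2-integral basis as soon as an integer combination [z] of it with
[z / 2] integral has even coefficients. Now if [z] is in [O] and [z / 2] is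
integral over Z, then the integral equation of [z / 2] shows that some power of
[z] is in [2 O] ([power_in_double_order]): [z] is nilpotent in [O / 2 O], an
algebra of dimension 4 over the field with two elements, in which everything
is a finite computation ([half_integral_descent]).

If [d = 2], then [O / 2 O] is [F_4[y] / (y^2 + (p0 + theta) y + ...)] with
[F_4 = F_2[theta]]; the quadratic polynomial is separable because its
derivative [p0 + theta] is a nonzero constant. Hence [O / 2 O] is reduced and
[z] is in [2 O] ([reduced_unramified], [saturated_unramified]).

If [d = 1], then [O / 2 O] is [F_4[y] / (y^2)], and nilpotency only says
[z = 2 u + v y], with [u] and [v] linear polynomials in [theta] over Z. But
[z^2 / 4] is integral as well, [z^2 / 2] is in [O], and its residue in [F_4]
is [v^2 (y^2 / 2)]. The residue of [y^2 / 2] is nonzero because [b + 1 - a]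
and [c - a] are not both divisible by 4; so [v] vanishes in [F_4]
([saturated_ramified]). *)

(** * Parity and the 2-adic valuation *)

(** [bool], with exclusive or and conjunction, is the field with two elements;
reduction modulo 2 is the canonical map [intr : int -> bool], and identities
between residues are decided by case analysis. *)
Lemma even_bool (k : int) : (2 %| k)%Z = (k%:~R == 0 :> bool).
Proof. by apply: dvdz_pcharf; rewrite inE. Qed.

Lemma even_F2 (k : int) : (2 %| k)%Z = (k%:~R == 0 :> 'F_2).
Proof. by apply: dvdz_pcharf; apply: pchar_Fp. Qed.

Lemma v2_eq1 (k : int) : v2 k = 1%:E -> ~~ (4 %| k)%Z.
Proof.
rewrite /v2; case: eqP => // /eqP k0 [/eqP l1]; apply/negP.
rewrite -[(4 %| k)%Z]/(2 ^ 2 %| `|k|)%N pfactor_dvdn ?absz_gt0 //.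
by move: l1; lia.
Qed.

Lemma v2_gt1 (k : int) : (1%:E < v2 k)%E -> (4 %| k)%Z.
Proof.
rewrite /v2; case: eqP => [->//|/eqP k0]; rewrite lte_fin => l1.
by rewrite -[(4 %| k)%Z]/(2 ^ 2 %| `|k|)%N pfactor_dvdn ?absz_gt0.
Qed.

(** * A criterion for 2-integral bases *)

Lemma common_denominator (I : finType) (r : I -> rat) :
  exists m : I -> int,
    forall i, (\prod_j denq (r j))%:~R * r i = (m i)%:~R.
Proof.
exists (fun i => (\prod_(j | j != i) denq (r j)) * numq (r i)) => i.
rewrite (bigD1 i) //= !rmorphM /= numqE; ring.
Qed.

Lemma Z_loc2_of_odd_multiple (N : nat) (r : rat) (m : int) :
  odd N -> N%:R * r = m%:~R -> r \in Z_loc2.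
Proof.
move=> oddN Nr; rewrite inE.
have: (N%:Z * numq r = m * denq r)%R.
  by apply: (@intr_inj rat); rewrite !rmorphM /= numqE -Nr mulrA -pmulrn.
move/(congr1 absz); rewrite !abszM absz_nat => e.
have: (`|denq r| %| N * `|numq r|)%N by rewrite e dvdn_mull.
rewrite Gauss_dvdl; last by rewrite coprime_sym coprime_num_den.
by move/dvdn_odd; apply.
Qed.

Lemma integral_sum (R K : comNzRingType) (RtoK : {rmorphism R -> K})
    (I : finType) (F : I -> K) :
  (forall i, integralOver RtoK (F i)) -> integralOver RtoK (\sum_i F i).
Proof.
move=> intF; elim/big_ind: _ => //; [exact: integral0 | exact: integral_add].
Qed.

Lemma odd_multiple_integral (L : closedFieldType) (iota : {rmorphism rat -> L})
    (theta x : L) :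
  in_integers_loc2 iota theta x ->
  exists2 N : nat, odd N & integralOver (intr : int -> L) (N%:R * x).
Proof.
case=> m [r] [z] [r_loc z_int ->].
exists `|(\prod_i denq (r i))%R|%N.
  elim/big_ind: _ => // [u v|i _]; first by rewrite abszM oddM => -> ->.
  by have := r_loc i; rewrite inE.
have [k kE] := common_denominator r.
have P_ge0 : 0 <= \prod_i denq (r i).
  by apply: prodr_ge0 => i _; exact: denq_ge0.
rewrite mulr_sumr; apply: integral_sum => i; rewrite mulrA.
apply: integral_mul; last by case: (z_int i).
suff -> : `|(\prod_i denq (r i))%R|%N%:R * iota (r i) = (k i)%:~R.
  by apply: integral_id.
rewrite -(rmorph_int iota (k i)) -kE rmorphM /= rmorph_int.
by rewrite -[X in X%:~R](gez0_abs P_ge0).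
Qed.

Section Criterion.
Variables (L : closedFieldType) (iota : {rmorphism rat -> L}) (theta : L).
Variables (n : nat) (B : n.-tuple L).

Definition rat_comb (u : 'rV[rat]_n) : L :=
  \sum_(i < n) iota (u 0 i) * tnth B i.

Lemma rat_combZ r u : rat_comb (r *: u) = iota r * rat_comb u.
Proof.
rewrite /rat_comb mulr_sumr; apply: eq_bigr => i _.
by rewrite mxE rmorphM mulrA.
Qed.

Lemma rat_combB u v : rat_comb (u - v) = rat_comb u - rat_comb v.
Proof.
rewrite /rat_comb -sumrB; apply: eq_bigr => i _.
by rewrite !mxE rmorphB mulrBl.
Qed.

Definition saturated_at2 := forall m : 'rV[int]_n,
  integralOver (intr : int -> L)
    ((\sum_(i < n) (m ord0 i)%:~R * tnth B i) / 2) ->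
  forall i, (2 %| m ord0 i)%Z.

Hypothesis sat : saturated_at2.

(** If [2 ^ k.+1 * u] has integer coordinates, they are even by saturation at 2,
so [2 ^ k * u] has integer coordinates too. *)
Lemma clear_power_of_2 k (u : 'rV[rat]_n) (m : 'I_n -> int) :
  integralOver (intr : int -> L) (rat_comb u) ->
  (forall i, 2 ^+ k * u 0 i = (m i)%:~R) ->
  exists m' : 'I_n -> int, forall i, u 0 i = (m' i)%:~R.
Proof.
move=> int_u; elim: k m => [|k IH] m mE.
  by exists m => i; rewrite -mE mul1r.
have two_neq0 : (2 : rat) != 0 by [].
have int_half : integralOver (intr : int -> L)
    ((\sum_(i < n) ((\row_i m i) ord0 i)%:~R * tnth B i) / 2).
  have -> : (\sum_(i < n) ((\row_i m i) ord0 i)%:~R * tnth B i) / 2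
      = (2 ^+ k)%:~R * rat_comb u.
    have -> : (2 ^+ k)%:~R = iota (2 ^+ k) :> L.
      by rewrite !rmorphXn /= rmorph_nat.
    rewrite -rat_combZ mulr_suml; apply: eq_bigr => i _; rewrite !mxE.
    have -> : (m i)%:~R = iota (2 * (2 ^+ k * u 0 i)) :> L.
      by rewrite mulrA -exprS mE rmorph_int.
    have iota2 : iota 2 = 2 :> L by rewrite rmorph_nat.
    have two0 : (2 : L) != 0 by rewrite -iota2 fmorph_eq0.
    by rewrite rmorphM iota2; field.
  by apply: integral_mul => //; apply: integral_id.
have even_m i : (2 %| m i)%Z by have := sat int_half i; rewrite mxE.
apply: (IH (fun i => (m i %/ 2)%Z)) => i.
apply: (mulfI two_neq0); rewrite mulrA -exprS mE -{1}(divzK (even_m i)).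
by rewrite rmorphM /= mulrC.
Qed.

Hypothesis B_integral : forall i, in_ring_of_integers iota theta (tnth B i).
Hypothesis B_span :
  forall x, in_Qadjoin iota theta x -> exists u, x = rat_comb u.
Hypothesis B_free : forall u, rat_comb u = 0 -> u = 0.

Lemma integers_loc2_span x :
  in_integers_loc2 iota theta x -> exists u, x = rat_comb u.
Proof.
case=> m [r] [z] [_ z_int ->].
elim/big_ind: _ => [|_ _ [u ->] [v ->]|i _].
- by exists 0; rewrite /rat_comb big1 // => i _; rewrite mxE rmorph0 mul0r.
- exists (u + v); rewrite /rat_comb -big_split; apply: eq_bigr => i _ /=.
  by rewrite !mxE rmorphD mulrDl.
- have [u ->] := B_span (proj1 (z_int i)).
  by exists (r i *: u); rewrite rat_combZ.
Qed.

(** For [x] in the localized ring of integers, an odd multiple [N x] is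
integral. Write a common denominator of the coordinates of [x] as [2 ^ k D']
with [D'] odd: the factor [D' N] keeps [x] integral and leaves only a power of
2 in the denominators, which saturation removes. *)
Lemma saturated_basis : is_2integral_basis iota theta B.
Proof.
split=> [i|x x_loc].
  exists 1%N, (fun=> 1), (fun=> tnth B i); split=> //.
  by rewrite big_ord1 rmorph1 mul1r.
have [u xE] := integers_loc2_span x_loc.
exists u; split; last first.
  move=> v [_ xE']; apply/eqP; rewrite -subr_eq0; apply/eqP.
  by apply: B_free; rewrite rat_combB -xE xE' subrr.
split; last exact: xE.
have [N oddN intNx] := odd_multiple_integral x_loc.
have [m mE] := common_denominator (u 0).
set D := \prod_j _ in mE.
have D_gt0 : 0 < D by apply: prodr_gt0 => j _; exact: denq_gt0.
have [|D' cop DE] := @pfactor_coprime 2 `|D|%N isT.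
  by rewrite absz_gt0 gt_eqF.
move: (logn 2 `|D|) DE => k DE.
have oddD' : odd D' by move: cop; rewrite coprime2n.
have [|i|m' m'E] := @clear_power_of_2 k ((D' * N)%:R *: u)
    (fun i => N%:Z * m i).
- rewrite rat_combZ rmorph_nat natrM -mulrA -xE.
  by apply: integral_mul => //; apply: integral_nat.
- rewrite mxE [RHS]rmorphM /= -mE -[D]gez0_abs ?ltW // DE -!pmulrn.
  rewrite !natrM natrX; ring.
move=> i; apply: (@Z_loc2_of_odd_multiple (D' * N) _ (m' i)).
  by rewrite oddM oddD'.
by rewrite -m'E mxE.
Qed.

End Criterion.

(** * The algebra with basis 1, t, y, ty *)

(** Coordinates with respect to [1, t, y, t * y]. *)
Definition quad (R : Type) : Type := (R * R * R * R)%type.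

Definition qmap (R S : Type) (f : R -> S) (m : quad R) : quad S :=
  let: (m0, m1, m2, m3) := m in (f m0, f m1, f m2, f m3).

Definition qscale (R : pzRingType) (r : R) : quad R -> quad R :=
  qmap (fun s => r * s).

Section QuadMul.
Variables (R : comNzRingType) (d p0 p1 q0 q1 : R).

(** [mul_t] and [mul_y] are multiplication by [t] and [y] under the relations
[t ^+ 2 = d * y - t - 1] and [y ^+ 2 = q0 + q1 * t + p0 * y + p1 * (t * y)].
The product is defined over any ring so that it can be compared over [int],
where it computes in an order, and over [bool], where it is decidable. *)
Definition mul_t (m : quad R) : quad R :=
  let: (m0, m1, m2, m3) := m in
  (- m1 + d * q0 * m3, m0 - m1 + d * q1 * m3,
   d * m1 - m3 + d * p0 * m3, m2 - m3 + d * p1 * m3).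

Definition mul_y (m : quad R) : quad R :=
  let: (m0, m1, m2, m3) := m in
  (0, 0, m0, m1) + qscale m2 (q0, q1, p0, p1)
  + qscale m3 (mul_t (q0, q1, p0, p1)).

Definition qmul (m n : quad R) : quad R :=
  let: (m0, m1, m2, m3) := m in
  qscale m0 n + qscale m1 (mul_t n) + qscale m2 (mul_y n)
  + qscale m3 (mul_y (mul_t n)).

Definition qsqr (m : quad R) : quad R := qmul m m.

Definition qeval (t y : R) (m : quad R) : R :=
  let: (m0, m1, m2, m3) := m in m0 + m1 * t + m2 * y + m3 * (t * y).

Lemma qevalD t y m n : qeval t y (m + n) = qeval t y m + qeval t y n.
Proof. case: m n => [[[m0 m1] m2] m3] [[[n0 n1] n2] n3] /=; ring. Qed.

Lemma qevalB t y m n : qeval t y (m - n) = qeval t y m - qeval t y n.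
Proof. case: m n => [[[m0 m1] m2] m3] [[[n0 n1] n2] n3] /=; ring. Qed.

Lemma qevalZ t y r m : qeval t y (qscale r m) = r * qeval t y m.
Proof. case: m => [[[m0 m1] m2] m3] /=; ring. Qed.

Variables t y : R.
Hypothesis tE : t ^+ 2 = d * y - t - 1.
Hypothesis yE : y ^+ 2 = q0 + q1 * t + p0 * y + p1 * (t * y).

Lemma qeval_mul_t m : qeval t y (mul_t m) = t * qeval t y m.
Proof.
case: m => [[[m0 m1] m2] m3] /=.
have -> : t * (m0 + m1 * t + m2 * y + m3 * (t * y))
  = m0 * t + m1 * t ^+ 2 + m2 * (t * y) + m3 * y * t ^+ 2 by ring.
rewrite tE.
have -> : m3 * y * (d * y - t - 1)
  = m3 * d * y ^+ 2 - m3 * (t * y) - m3 * y by ring.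
rewrite yE; ring.
Qed.

Lemma qeval_mul_y m : qeval t y (mul_y m) = y * qeval t y m.
Proof.
case: m => [[[m0 m1] m2] m3].
rewrite /mul_y !qevalD !qevalZ qeval_mul_t /= -yE; ring.
Qed.

Lemma qeval_mul m n : qeval t y (qmul m n) = qeval t y m * qeval t y n.
Proof.
case: m => [[[m0 m1] m2] m3].
rewrite /qmul !qevalD !qevalZ !(qeval_mul_t, qeval_mul_y) /=; ring.
Qed.

End QuadMul.

Section QuadMap.
Variables (R S : comNzRingType) (f : {rmorphism R -> S}).

Lemma qmap_mul (d p0 p1 q0 q1 : R) m n :
  qmap f (qmul d p0 p1 q0 q1 m n)
  = qmul (f d) (f p0) (f p1) (f q0) (f q1) (qmap f m) (qmap f n).
Proof.
case: m n => [[[m0 m1] m2] m3] [[[n0 n1] n2] n3] /=.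
by do !congr (_, _); rewrite /= ?(rmorphD, rmorphB, rmorphN, rmorphM, rmorph0).
Qed.

Lemma qmap_scale r m : qmap f (qscale r m) = qscale (f r) (qmap f m).
Proof. by case: m => [[[m0 m1] m2] m3] /=; rewrite !rmorphM. Qed.

Lemma qmapD m n : qmap f (m + n) = qmap f m + qmap f n.
Proof.
by case: m n => [[[m0 m1] m2] m3] [[[n0 n1] n2] n3] /=; rewrite !rmorphD.
Qed.

Lemma qmapB m n : qmap f (m - n) = qmap f m - qmap f n.
Proof.
by case: m n => [[[m0 m1] m2] m3] [[[n0 n1] n2] n3] /=; rewrite !rmorphB.
Qed.

End QuadMap.

Lemma qmap_double (m : quad int) : qmap intr (qscale 2 m) = 0 :> quad bool.
Proof.
by rewrite (qmap_scale intr); case: (qmap _ m) => [[[[] []] []] []].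
Qed.

(** The residue algebra for [d = 2], a separable quadratic algebra over [F_4]:
it has no nilpotent elements, because squaring is injective. *)
Lemma reduced_unramified (p0 q0 q1 : bool) (m : quad bool) :
  qsqr 0 p0 1 q0 q1 m = 0 -> m = 0.
Proof. by case: m => [[[[] []] []] []]; case: p0; case: q0; case: q1. Qed.

(** The residue algebra for [d = 1] is [F_4[y] / (y ^+ 2)]; the first two
coordinates [m.1.1] give the image in its residue field [F_4], where squaring
is injective. *)
Lemma reduced_residue_ramified (m : quad bool) :
  (qsqr 1 0 0 0 0 m).1.1 = 0 -> m.1.1 = 0.
Proof. by case: m => [[[[] []] []] []]. Qed.

(** In [F_4], the product of [(v0 + v1 t) ^+ 2] and the nonzero [q0 + q1 t]
vanishes only if [v0 + v1 t] does. *)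
Lemma residue_mul_eq0 (v0 v1 p0 q0 q1 : bool) : (q0, q1) != 0 ->
  (qmul 1 0 0 0 0 (qsqr 1 0 0 0 0 (v0, v1, 0, 0)) (q0, q1, p0, 1)).1.1 = 0 ->
  (v0, v1) = 0.
Proof. by case: v0 v1 p0 q0 q1 => [] [] [] [] []. Qed.

(** * Halves of elements of an order *)

Section Order.
Variables (L : closedFieldType) (d p0 p1 q0 q1 : int) (t y : L).

Let ev (m : quad int) : L := qeval t y (qmap intr m).
Let red (m : quad int) : quad bool := qmap intr m.
Let sqr := qsqr d p0 p1 q0 q1.
Let sqr2 : quad bool -> quad bool :=
  qsqr d%:~R p0%:~R p1%:~R q0%:~R q1%:~R.

Hypothesis two0 : (2 : L) != 0.
Hypothesis tE : t ^+ 2 = d%:~R * y - t - 1.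
Hypothesis yE :
  y ^+ 2 = q0%:~R + q1%:~R * t + p0%:~R * y + p1%:~R * (t * y).
Hypothesis ev_free : forall m, ev m = 0 -> m = 0.

Definition in_order (x : L) := exists m, x = ev m.

Lemma in_orderD x x' : in_order x -> in_order x' -> in_order (x + x').
Proof.
by move=> [m ->] [n ->]; exists (m + n); rewrite /ev (qmapD intr) qevalD.
Qed.

Lemma evM m n : ev (qmul d p0 p1 q0 q1 m n) = ev m * ev n.
Proof. by rewrite /ev (qmap_mul intr); apply: qeval_mul. Qed.

Lemma in_orderM x x' : in_order x -> in_order x' -> in_order (x * x').
Proof. by move=> [m ->] [n ->]; rewrite -evM; eexists. Qed.

Lemma in_order_int k : in_order k%:~R.
Proof. by exists (k, 0, 0, 0); rewrite /ev /= !mul0r !addr0. Qed.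

Lemma in_orderX x n : in_order x -> in_order (x ^+ n).
Proof.
move=> Ox; elim: n => [|n IH]; first exact: (in_order_int 1).
by rewrite exprS; apply: in_orderM.
Qed.

(** Multiply a monic integral equation of [x / 2], of degree [n], by [2 ^+ n]:
every term but [x ^+ n] acquires a factor 2. *)
Lemma power_in_double_order (x : L) :
  integralOver (intr : int -> L) (x / 2) -> in_order x ->
  exists n w, in_order w /\ x ^+ n = 2 * w.
Proof.
move=> [p p_monic rootp] Ox; pose n := (size p).-1; exists n.
exists (- \sum_(i < n) (p`_i * 2 ^+ (n - i).-1)%:~R * x ^+ i); split.
  rewrite -sumrN; elim/big_ind: _ => [||i _]; first exact: (in_order_int 0).
    exact: in_orderD.
  rewrite -mulNr -rmorphN.
  exact: in_orderM (in_order_int _) (in_orderX _ Ox).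
move/rootP: rootp; rewrite horner_coef size_map_poly_id0; last first.
  by rewrite (monicP p_monic) rmorph1 oner_eq0.
rewrite -[size p]prednK ?size_poly_gt0 ?monic_neq0 // -/n big_ord_recr /=.
rewrite !coef_map /=.
have -> : p`_n = 1 by move/monicP: p_monic.
rewrite mul1r addrC => /eqP; rewrite addr_eq0 => /eqP xn.
have -> : x ^+ n = 2 ^+ n * (x / 2) ^+ n.
  by rewrite -exprMn mulrCA divff ?mulr1.
rewrite xn !mulrN mulr_sumr mulr_sumr; congr (- _).
apply: eq_bigr => i _.
rewrite coef_map /= rmorphM rmorphXn /= expr_div_n.
have -> : 2 ^+ n = 2 * 2 ^+ (n - i).-1 * 2 ^+ i :> L.
  by rewrite -exprS prednK ?subn_gt0 // -exprD subnK // ltnW.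
have : (2 : L) ^+ i != 0 by rewrite expf_neq0.
by move=> ?; field.
Qed.

(** Only iterated squares are computed in coordinates: [n <= 2 ^ n], so the
power [2 ^ n] is in [2 O] as soon as the power [n] is. *)
Lemma half_integral_nilpotent (m : quad int) :
  integralOver (intr : int -> L) (ev m / 2) ->
  exists k, iter k sqr2 (red m) = 0.
Proof.
move=> /power_in_double_order[|n [w [Ow nE]]]; first by exists m.
exists n.
have evI k : ev (iter k sqr m) = ev m ^+ (2 ^ k).
  elim: k => [|k IH]; first by rewrite expr1.
  by rewrite iterS /sqr /qsqr evM IH -exprD addnn -mul2n -expnS.
have redI k : red (iter k sqr m) = iter k sqr2 (red m).
  elim: k => //= k IH.
  by rewrite -IH /red /sqr /qsqr (qmap_mul intr).
have [v vE] : in_order (w * ev m ^+ (2 ^ n - n)).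
  by apply: in_orderM => //; apply: in_orderX; exists m.
rewrite -redI.
have -> : iter n sqr m = qscale 2 v; last exact: qmap_double.
apply/eqP; rewrite -subr_eq0; apply/eqP/ev_free.
rewrite {1}/ev (qmapB intr) (qmap_scale intr) qevalB qevalZ -!/(ev _).
rewrite evI -vE mulrA -nE -exprD subnKC ?subrr //.
by apply: ltnW; apply: ltn_expl.
Qed.

(** A property of residues that holds at 0 and descends along squares holds at
every nilpotent residue. *)
Lemma half_integral_descent (P : quad bool -> Prop) m :
  P 0 -> (forall v, P (sqr2 v) -> P v) ->
  integralOver (intr : int -> L) (ev m / 2) -> P (red m).
Proof.
move=> P0 Psqr /half_integral_nilpotent[k kE].
by elim: k (red m) kE => [v /= ->//|k IH v]; rewrite iterSr => /IH/Psqr.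
Qed.

End Order.

(** * Quartics that are squares modulo 2 *)

Lemma quartic_map (R : nzRingType) (a b c : int) :
  map_poly intr (quartic a b c)
    = 'X^4 + a%:~R *: 'X^2 + b%:~R *: 'X + (c%:~R)%:P :> {poly R}.
Proof.
by rewrite /quartic !rmorphD /= !linearZ /= map_polyC /= !map_polyXn map_polyX.
Qed.

Lemma irreducible_size3_no_root (K : fieldType) (p : {poly K}) x :
  irreducible_poly p -> size p = 3%N -> ~~ root p x.
Proof.
move=> irr_p sz_p; apply/negP; rewrite root_factor_theorem => x_dvd.
have : 'X - x%:P %= p by apply: apply_irredp x_dvd; rewrite // size_XsubC.
by move/eqp_size; rewrite size_XsubC sz_p.
Qed.

Lemma F2P (x : 'F_2) : x = 0 \/ x = 1.
Proof. by case: x => -[|[|//]] ?; [left|right]; apply: val_inj. Qed.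

Lemma F2_neq0 (x : 'F_2) : x != 0 -> x = 1.
Proof. by case: (F2P x) => -> //; rewrite eqxx. Qed.

Lemma size_X2X1 : size ('X^2 + 'X + 1 : {poly 'F_2}) = 3%N.
Proof. by rewrite -addrA size_polyDl ?size_polyXn // size_XaddC. Qed.

Lemma irreducible_X2X1 : irreducible_poly ('X^2 + 'X + 1 : {poly 'F_2}).
Proof.
apply: cubic_irreducible => [|x]; first by rewrite size_X2X1.
by rewrite /root !hornerE; case: (F2P x) => ->.
Qed.

(** [X^2 + X + 1] is the only irreducible quadratic polynomial over [F_2]: the
absence of the roots 0 and 1 forces its coefficients. *)
Lemma quartic_square_mod2 (a b c : int) :
  [/\ (2 %| b)%Z, ~~ (2 %| a)%Z & ~~ (2 %| c)%Z] <->
   exists q : {poly 'F_2}, [/\ irreducible_poly q, size q = 3%N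
     & map_poly intr (quartic a b c) = q ^+ 2].
Proof.
rewrite quartic_map !even_F2; split.
  case=> /eqP -> a1 c1; exists ('X^2 + 'X + 1); split.
  - exact: irreducible_X2X1.
  - exact: size_X2X1.
  rewrite (F2_neq0 a1) (F2_neq0 c1) scale1r scale0r.
  have two0 : 2 = 0 :> {poly 'F_2}.
    by rewrite -polyC_natr; congr (_%:P); apply: val_inj.
  have -> : ('X^2 + 'X + 1) ^+ 2
      = 'X^4 + 'X^2 + 1 + 2 * ('X^3 + 'X^2 + 'X) :> {poly 'F_2} by ring.
  by rewrite two0 mul0r !addr0.
case=> q [irr_q sz_q qE].
have q2 : q`_2 = 1.
  have : lead_coef q != 0 by rewrite lead_coef_eq0 irredp_neq0.
  by rewrite lead_coefE sz_q => /F2_neq0.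
have qX : q = (q`_0)%:P + q`_1 *: 'X + 'X^2.
  apply/polyP => i; rewrite !coefD coefC coefZ coefX coefXn.
  case: i => [|[|[|i]]]; rewrite /= ?mulr0 ?mulr1 ?addr0 ?add0r //.
  by rewrite nth_default // sz_q.
have r0 := irreducible_size3_no_root 0 irr_q sz_q.
have r1 := irreducible_size3_no_root 1 irr_q sz_q.
have q0 : q`_0 = 1.
  by move: r0; rewrite /root horner_coef0 => /F2_neq0.
have q1 : q`_1 = 1.
  case: (F2P q`_1) => [q10|//]; exfalso.
  by move: r1; rewrite /root qX q0 q10 !hornerE.
have sqE : q ^+ 2 = 'X^4 + 2 *: 'X^3 + 3 *: 'X^2 + 2 *: 'X + 1%:P.
  rewrite qX q0 q1 scale1r -!mul_polyC !polyC_natr; ring.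
move: qE; rewrite sqE => qE.
have cE i := congr1 (fun p : {poly 'F_2} => p`_i) qE.
have := cE 0%N; have := cE 1%N; have := cE 2.
rewrite !coefD !coefC !coefZ !coefX !coefXn /= !(mulr0,mulr1,addr0,add0r).
by move=> -> -> ->.
Qed.

(** * The field generated by a root of an irreducible polynomial *)

Section Adjoin.
Variables (L : closedFieldType) (iota : {rmorphism rat -> L}) (theta : L).
Variable F : {poly rat}.
Hypothesis irrF : irreducible_poly F.
Hypothesis rootF : root (map_poly iota F) theta.

Lemma inverse_mod_minpoly (g : {poly rat}) : (map_poly iota g).[theta] != 0 ->
  exists h, (map_poly iota h).[theta] * (map_poly iota g).[theta] = 1.
Proof.
move=> g_theta.
have : coprimep F g.
  rewrite irreducible_poly_coprime //; apply: contra g_theta => /dvdpP[h ->].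
  by rewrite rmorphM hornerM (rootP rootF) mulr0.
case/Bezout_eq1_coprimepP=> -[u v] /= uv; exists v.
have := congr1 (fun p => (map_poly iota p).[theta]) uv.
rewrite rmorphD !rmorphM rmorph1 hornerD !hornerM hornerC (rootP rootF).
by rewrite mulr0 add0r.
Qed.

Lemma small_poly_root (g : {poly rat}) :
  (size g < size F)%N -> (map_poly iota g).[theta] = 0 -> g = 0.
Proof.
move=> sz_g g_theta; apply: contraTeq sz_g => g0; rewrite -leqNgt.
apply: dvdp_leq => //; apply: contraT.
rewrite -irreducible_poly_coprime // => /Bezout_eq1_coprimepP[[u v] /= uv].
have := congr1 (fun p => (map_poly iota p).[theta]) uv.
rewrite rmorphD !rmorphM rmorph1 hornerD !hornerM hornerC (rootP rootF) g_theta.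
by rewrite !mulr0 addr0 => /esym/eqP; rewrite oner_eq0.
Qed.

Lemma Qadjoin_poly x : in_Qadjoin iota theta x ->
  exists2 g : {poly rat}, (size g < size F)%N & x = (map_poly iota g).[theta].
Proof.
move=> [p [q [q_theta ->]]]; have [h hq] := inverse_mod_minpoly q_theta.
exists ((p * h) %% F); first by rewrite ltn_modp irredp_neq0.
rewrite -[(map_poly _ p).[_]]mulr1 -hq mulrA mulfK // -hornerM -rmorphM.
rewrite {1}(divp_eq (p * h) F) rmorphD rmorphM hornerD hornerM.
by rewrite (rootP rootF) mulr0 add0r.
Qed.

End Adjoin.

Section CubicValue.
Variables (L : closedFieldType) (iota : {rmorphism rat -> L}) (t : L).

Lemma horner_size4 (g : {poly rat}) : (size g <= 4)%N ->
  (map_poly iota g).[t]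
  = iota g`_0 + iota g`_1 * t + iota g`_2 * t ^+ 2 + iota g`_3 * t ^+ 3.
Proof.
move=> sz_g; rewrite (horner_coef_wide (n := 4)); last first.
  exact: leq_trans (size_poly _ _) sz_g.
by rewrite !big_ord_recr big_ord0 /= !coef_map add0r expr0 mulr1.
Qed.

Lemma ring_of_integers_cubic (c0 c1 c2 c3 : rat) x :
  x = iota c0 + iota c1 * t + iota c2 * t ^+ 2 + iota c3 * t ^+ 3 ->
  integralOver (intr : int -> L) x -> in_ring_of_integers iota t x.
Proof.
move=> xE x_int; split=> //; pose g := Poly [:: c0; c1; c2; c3]; exists g, 1.
rewrite rmorph1 hornerC oner_eq0 divr1; split=> //.
by rewrite horner_size4 ?(size_Poly [:: _; _; _; _]) // !coef_Poly xE.
Qed.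

End CubicValue.

Lemma sum_tuple4 (L : pzRingType) (F : 'I_4 -> L) (x0 x1 x2 x3 : L) :
  \sum_(i < 4) F i * tnth [tuple x0; x1; x2; x3] i
  = F (inord 0) * x0 + F (inord 1) * x1 + F (inord 2) * x2 + F (inord 3) * x3.
Proof.
rewrite !big_ord_recr big_ord0 /= add0r.
by do !congr (_ + _); congr (F _ * _); apply: val_inj; rewrite /= inordK.
Qed.

Lemma forall_ord4 (P : 'I_4 -> Prop) :
  P (inord 0) -> P (inord 1) -> P (inord 2) -> P (inord 3) -> forall i, P i.
Proof.
move=> P0 P1 P2 P3 i; rewrite -(inord_val i).
by case: i => -[|[|[|[|//]]]].
Qed.

Lemma row4_eq0 (R : pzRingType) (u : 'rV[R]_4) :
  u 0 (inord 0) = 0 -> u 0 (inord 1) = 0 -> u 0 (inord 2) = 0 ->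
  u 0 (inord 3) = 0 -> u = 0.
Proof.
by move=> u0 u1 u2 u3; apply/rowP; apply: forall_ord4; rewrite mxE.
Qed.

(** * The order attached to the quartic *)

Section Quartic.
Variables (a b c : int) (L : closedFieldType) (iota : {rmorphism rat -> L}).
Variable t : L.
Hypothesis irr_f :
  irreducible_poly (map_poly intr (quartic a b c) : {poly rat}).
Hypothesis root_t : root (map_poly intr (quartic a b c)) t.

Lemma tail_lt_X4 (R : nzRingType) (u v w : R) :
  (size (u *: 'X^2 + (v *: 'X + w%:P))%R < size ('X^4 : {poly R})%R)%N.
Proof.
rewrite size_polyXn ltnS.
have tail3 : (size (u *: 'X^2 + (v *: 'X + w%:P))%R <= 3)%N.
  apply/leq_sizeP => -[|[|[|j]]] // _.
  by rewrite !coefD !coefZ coefXn coefX coefC /= !mulr0 !addr0.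
exact: leq_trans tail3 _.
Qed.

Lemma size_quartic (R : nzRingType) :
  size (map_poly intr (quartic a b c) : {poly R}) = 5%N.
Proof.
by rewrite quartic_map -!addrA size_polyDl ?tail_lt_X4 // size_polyXn.
Qed.

Lemma quartic_monic (R : nzRingType) :
  (map_poly intr (quartic a b c) : {poly R}) \is monic.
Proof.
by rewrite monicE quartic_map -!addrA lead_coefDl ?tail_lt_X4 // lead_coefXn.
Qed.

Lemma root_iota : root (map_poly iota (map_poly intr (quartic a b c))) t.
Proof.
rewrite -map_poly_comp (eq_map_poly (g := intr)) //.
by move=> k /=; rewrite rmorph_int.
Qed.

Lemma t_pow4 : t ^+ 4 = - (a%:~R * t ^+ 2 + b%:~R * t + c%:~R).
Proof.
move/rootP: root_t; rewrite quartic_map !hornerE.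
by rewrite -!addrA => /eqP; rewrite addr_eq0 => /eqP ->; rewrite !addrA.
Qed.

Lemma t_integral : integralOver (intr : int -> L) t.
Proof.
apply: (integral_root_monic (quartic_monic L) root_t).
by apply/integral_poly => i; rewrite coef_map; apply: integral_id.
Qed.

Lemma power_span x : in_Qadjoin iota t x -> exists c0 c1 c2 c3 : rat,
  x = iota c0 + iota c1 * t + iota c2 * t ^+ 2 + iota c3 * t ^+ 3.
Proof.
case/(Qadjoin_poly irr_f root_iota) => g; rewrite size_quartic ltnS => sz_g ->.
by exists g`_0, g`_1, g`_2, g`_3; apply: horner_size4.
Qed.

Lemma power_free (c0 c1 c2 c3 : rat) :
  iota c0 + iota c1 * t + iota c2 * t ^+ 2 + iota c3 * t ^+ 3 = 0 ->
  [/\ c0 = 0, c1 = 0, c2 = 0 & c3 = 0].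
Proof.
move=> e; pose g := Poly [:: c0; c1; c2; c3].
have sz_g : (size g <= 4)%N := size_Poly _.
have g0 : g = 0.
  apply: (small_poly_root irr_f root_iota); first by rewrite size_quartic.
  by rewrite -[RHS]e horner_size4 // !coef_Poly.
have gi i : nth 0 [:: c0; c1; c2; c3] i = 0 by rewrite -coef_Poly -/g g0 coef0.
by split; [exact: (gi 0%N)|exact: (gi 1%N)|exact: (gi 2)|exact: (gi 3)].
Qed.

Lemma intr_neq0 (k : int) : k != 0 -> k%:~R != 0 :> L.
Proof. by move=> k0; rewrite -(rmorph_int iota) fmorph_eq0 intr_eq0. Qed.

Variables (d p0 p1 q0 q1 : int).
Hypotheses (d0 : d != 0) (p0E : d * p0 = 1 - a) (p1E : d * p1 = 2).
Hypotheses (q0E : d ^+ 2 * q0 = a - c) (q1E : d ^+ 2 * q1 = a - b - 1).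

Let y := (t ^+ 2 + t + 1) / d%:~R.

Lemma t_sqr : t ^+ 2 = d%:~R * y - t - 1.
Proof. by have := intr_neq0 d0; rewrite /y => ?; field. Qed.

Lemma y_sqr : y ^+ 2 = q0%:~R + q1%:~R * t + p0%:~R * y + p1%:~R * (t * y).
Proof.
have dL := intr_neq0 d0.
have q1L : d%:~R ^+ 2 * q1%:~R = a%:~R - b%:~R - 1 :> L.
  by rewrite -rmorphXn -rmorphM q1E !rmorphB.
have q0L : d%:~R ^+ 2 * q0%:~R = a%:~R - c%:~R :> L.
  by rewrite -rmorphXn -rmorphM q0E rmorphB.
have p1L : d%:~R * p1%:~R = 2 :> L by rewrite -rmorphM p1E.
have p0L : d%:~R * p0%:~R = 1 - a%:~R :> L by rewrite -rmorphM p0E rmorphB.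
apply: (mulfI (expf_neq0 2 dL)).
have -> : d%:~R ^+ 2 * y ^+ 2 = (t ^+ 2 + t + 1) ^+ 2.
  by rewrite -exprMn mulrC /y divfK.
have -> : d%:~R ^+ 2 * (q0%:~R + q1%:~R * t + p0%:~R * y + p1%:~R * (t * y))
  = d%:~R ^+ 2 * q0%:~R + (d%:~R ^+ 2 * q1%:~R) * t
    + (d%:~R * p0%:~R) * (t ^+ 2 + t + 1)
    + (d%:~R * p1%:~R) * (t * (t ^+ 2 + t + 1)) by rewrite /y; field.
rewrite q1L q0L p1L p0L.
have -> : (t ^+ 2 + t + 1) ^+ 2
   = t ^+ 4 + 2 * t ^+ 3 + 3 * t ^+ 2 + 2 * t + 1 by ring.
rewrite t_pow4; ring.
Qed.

Lemma y_integral : integralOver (intr : int -> L) y.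
Proof.
have t_int := t_integral.
have kint k : integralOver (intr : int -> L) k%:~R by apply: integral_id.
pose r := - (p0%:~R + p1%:~R * t); pose s := - (q0%:~R + q1%:~R * t).
have r_int : integralOver (intr : int -> L) r.
  by apply: integral_opp; apply: integral_add => //; apply: integral_mul.
have s_int : integralOver (intr : int -> L) s.
  by apply: integral_opp; apply: integral_add => //; apply: integral_mul.
pose p : {poly L} := 'X^2 + r *: 'X + s%:P.
have sz : (size (r *: 'X + s%:P)%R < size ('X^2 : {poly L})%R)%N.
  rewrite size_polyXn ltnS; apply/leq_sizeP => -[|[|j]] // _.
  by rewrite coefD coefZ coefX coefC mulr0 addr0.
apply: (@integral_root_monic _ _ _ _ p).
- by rewrite monicE /p -addrA lead_coefDl // lead_coefXn.
- rewrite /root /p !(hornerD, hornerZ, hornerX, hornerXn, hornerC) y_sqr.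
  by apply/eqP; rewrite /r /s; ring.
apply/integral_poly => i; rewrite !coefD coefXn coefZ coefX coefC.
do !apply: integral_add; first exact: integral_nat.
  by apply: integral_mul; last exact: integral_nat.
by case: ifP => // _; exact: integral0.
Qed.

Lemma ty_span x : in_Qadjoin iota t x -> exists c0 c1 c2 c3 : rat,
  x = iota c0 + iota c1 * t + iota c2 * y + iota c3 * (t * y).
Proof.
have dL := intr_neq0 d0.
case/power_span => c0 [c1 [c2 [c3 ->]]].
(* t ^ 2 = d y - t - 1 and t ^ 3 = d t y - d y + 1. *)
exists (c0 - c2 + c3), (c1 - c2), (d%:~R * (c2 - c3)), (d%:~R * c3).
by rewrite !(rmorphD, rmorphN, rmorphM) /= rmorph_int /y; field.
Qed.

Lemma ty_free (c0 c1 c2 c3 : rat) :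
  iota c0 + iota c1 * t + iota c2 * y + iota c3 * (t * y) = 0 ->
  [/\ c0 = 0, c1 = 0, c2 = 0 & c3 = 0].
Proof.
move=> e; have dL := intr_neq0 d0.
have dQ : d%:~R != 0 :> rat by rewrite intr_eq0.
have [] := @power_free (d%:~R * c0 + c2) (d%:~R * c1 + c2 + c3) (c2 + c3) c3.
  by rewrite -[RHS](mulr0 d%:~R) -e /y !(rmorphD, rmorphM) /= rmorph_int; field.
move=> e0 e1 e2 e3; move: e2 e1 e0; rewrite e3 addr0 => ->.
by rewrite !addr0 => /eqP + /eqP; rewrite !mulf_eq0 (negPf dQ) => /eqP -> /eqP ->.
Qed.

Let ev (m : quad int) : L := qeval t y (qmap intr m).

Lemma ev_free m : ev m = 0 -> m = 0.
Proof.
case: m => [[[m0 m1] m2] m3]; rewrite /ev /= -!(rmorph_int iota) => /ty_free[].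
by do 4![move=> /eqP; rewrite intr_eq0 => /eqP ->].
Qed.

(** The residue of [m] in [F_4] vanishes because it is nilpotent; the same
argument applied to half the square of [ev m], which is again in the order,
gives the other two coordinates. *)
Lemma saturated_ramified m :
  d = 1 -> (2 %| p0)%Z -> (2 %| q0)%Z -> (2 %| q1)%Z ->
  ~~ ((4 %| q0)%Z && (4 %| q1)%Z) ->
  integralOver (intr : int -> L) (ev m / 2) -> qmap intr m = 0 :> quad bool.
Proof.
move=> d1 even_p0 even_q0 even_q1 q_not4.
have two0 : (2 : L) != 0 := intr_neq0 (k := 2) isT.
have p1_2 : p1 = 2 by move: p1E; rewrite d1 mul1r.
have residue n : integralOver (intr : int -> L) (ev n / 2) ->
    (qmap intr n : quad bool).1.1 = 0.
  apply: (half_integral_descent (P := fun v => v.1.1 = 0)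
            two0 t_sqr y_sqr ev_free) => // v.
  move: even_p0 even_q0 even_q1; rewrite !even_bool => /eqP -> /eqP -> /eqP ->.
  rewrite d1 p1_2; exact: reduced_residue_ramified.
case: m => [[[m0 m1] m2] m3] int_m.
have [m0_even m1_even] := residue _ int_m.
pose k0 := (m0 %/ 2)%Z; pose k1 := (m1 %/ 2)%Z.
have m0E : m0 = k0 * 2 by rewrite divzK // even_bool m0_even.
have m1E : m1 = k1 * 2 by rewrite divzK // even_bool m1_even.
pose P0 := (p0 %/ 2)%Z; pose Q0 := (q0 %/ 2)%Z; pose Q1 := (q1 %/ 2)%Z.
have P0E : p0 = P0 * 2 by rewrite divzK.
have Q0E : q0 = Q0 * 2 by rewrite divzK.
have Q1E : q1 = Q1 * 2 by rewrite divzK.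
pose mul := qmul d p0 p1 q0 q1.
(* With ev m = 2 u + v y and y ^ 2 = 2 h, half the square of ev m is
   2 u ^ 2 + 2 u v y + v ^ 2 h; its coordinates are w. *)
pose u : quad int := (k0, k1, 0, 0); pose v : quad int := (m2, m3, 0, 0).
pose h : quad int := (Q0, Q1, P0, 1).
pose w := qscale 2 (mul u u) + qscale 2 (mul (mul u v) (0, 0, 1, 0))
  + mul (mul v v) h.
have evMul u' v' : ev (mul u' v') = ev u' * ev v' by apply: evM t_sqr y_sqr _ _.
have evD u' v' : ev (u' + v') = ev u' + ev v'.
  by rewrite /ev (qmapD intr) qevalD.
have ev2 u' : ev (qscale 2 u') = 2 * ev u'.
  by rewrite /ev (qmap_scale intr) qevalZ.
have wE : ev w = ev (m0, m1, m2, m3) ^+ 2 / 2.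
  rewrite /w 2!evD 2!ev2 !evMul.
  apply: (canRL (mulfK two0)).
  have -> : ev (m0, m1, m2, m3) = 2 * ev u + ev v * y.
    by rewrite /ev /= m0E m1E !rmorphM /=; ring.
  have -> : ev (0, 0, 1, 0) = y by rewrite /ev /=; ring.
  have y2E : y ^+ 2 = 2 * ev h.
    by rewrite y_sqr /ev /= Q0E Q1E P0E p1_2 !rmorphM /=; ring.
  have -> : (2 * ev u + ev v * y) ^+ 2
    = 4 * ev u ^+ 2 + 4 * ev u * ev v * y + ev v ^+ 2 * y ^+ 2 by ring.
  by rewrite y2E; ring.
have int_w : integralOver (intr : int -> L) (ev w / 2).
  have -> : ev w / 2 = (ev (m0, m1, m2, m3) / 2) ^+ 2 by rewrite wE; field.
  by rewrite expr2; apply: integral_mul.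
have := residue _ int_w.
have redM u' v' : qmap intr (mul u' v')
    = qmul 1 0 0 0 0 (qmap intr u') (qmap intr v') :> quad bool.
  transitivity (qmul d%:~R p0%:~R p1%:~R q0%:~R q1%:~R
    (qmap intr u') (qmap intr v') : quad bool); first exact: (qmap_mul intr).
  move: even_p0 even_q0 even_q1; rewrite !even_bool => /eqP -> /eqP -> /eqP ->.
  by rewrite d1 p1_2.
rewrite /w 2!(qmapD intr) 2!qmap_double !add0r !redM => sq0.
have Q_odd : (Q0%:~R, Q1%:~R) != 0 :> bool * bool.
  apply: contra q_not4 => /eqP[Q0_even Q1_even].
  have four (k : int) : (2 %| k)%Z -> (4 %| k * 2)%Z by lia.
  by rewrite Q0E Q1E !four // even_bool; apply/eqP.
have /= [-> ->] := residue_mul_eq0 Q_odd sq0.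
by rewrite m0_even m1_even.
Qed.

Lemma saturated_unramified m :
  d = 2 -> integralOver (intr : int -> L) (ev m / 2) ->
  qmap intr m = 0 :> quad bool.
Proof.
move=> d2; have two0 : (2 : L) != 0 := intr_neq0 (k := 2) isT.
apply: (half_integral_descent (P := fun v => v = 0)
          two0 t_sqr y_sqr ev_free) => // v.
have -> : p1 = 1 by move: p1E; rewrite d2; lia.
rewrite d2; exact: reduced_unramified.
Qed.

End Quartic.

(** * The two bases *)

Section Bases.
Variables (a b c : int) (L : closedFieldType) (iota : {rmorphism rat -> L}).
Variable t : L.
Hypothesis irr_f :
  irreducible_poly (map_poly intr (quartic a b c) : {poly rat}).
Hypothesis root_t : root (map_poly intr (quartic a b c)) t.
Hypotheses (even_b : (2 %| b)%Z) (odd_a : ~~ (2 %| a)%Z).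
Hypothesis (odd_c : ~~ (2 %| c)%Z).

Lemma power_basis : ~~ ((4 %| b + 1 - a)%Z && (4 %| c - a)%Z) ->
  is_2integral_basis iota t [tuple 1; t; t ^+ 2; t ^+ 3].
Proof.
move=> not4.
have t_int := t_integral root_t.
have tX_int n : integralOver (intr : int -> L) (t ^+ n).
  elim: n => [|n IH]; first exact: integral1.
  by rewrite exprS; apply: integral_mul.
apply: saturated_basis.
- move=> m; rewrite sum_tuple4 => int_m.
  (* The unimodular change of basis from the powers of t to 1, t, y, t y, from
     t ^ 2 = y - t - 1 and t ^ 3 = t y - y + 1. *)
  have [] : qmap intr
      (m ord0 (inord 0) - m ord0 (inord 2) + m ord0 (inord 3),
       m ord0 (inord 1) - m ord0 (inord 2),
       m ord0 (inord 2) - m ord0 (inord 3), m ord0 (inord 3)) = 0 :> quad bool.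
    apply: (@saturated_ramified a b c L iota t irr_f root_t
              1 (1 - a) 2 (a - c) (a - b - 1)) => //; try ring; try lia.
    congr (integralOver _ (_ / 2)): int_m.
    by rewrite /= divr1 !(rmorphD, rmorphN) /=; ring.
  move=> /eqP + /eqP + /eqP + /eqP; rewrite -!even_bool => e0 e1 e2 e3.
  by apply: forall_ord4; lia.
- apply: forall_ord4; rewrite (tnth_nth 0) /= inordK //=.
  + apply: (@ring_of_integers_cubic L iota t 1 0 0 0); last exact: integral1.
    by rewrite rmorph1 rmorph0; ring.
  + apply: (@ring_of_integers_cubic L iota t 0 1 0 0) => //.
    by rewrite rmorph1 rmorph0; ring.
  + apply: (@ring_of_integers_cubic L iota t 0 0 1 0) => //.
    by rewrite rmorph1 rmorph0; ring.
  + apply: (@ring_of_integers_cubic L iota t 0 0 0 1) => //.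
    by rewrite rmorph1 rmorph0; ring.
- move=> x /(power_span irr_f root_t)[c0 [c1 [c2 [c3 ->]]]].
  exists (\row_i nth 0 [:: c0; c1; c2; c3] i).
  by rewrite /rat_comb sum_tuple4 !mxE !inordK //= mulr1.
- move=> u; rewrite /rat_comb sum_tuple4 mulr1.
  case/(power_free irr_f root_t); exact: row4_eq0.
Qed.

Lemma divided_basis : (4 %| b + 1 - a)%Z -> (4 %| c - a)%Z ->
  is_2integral_basis iota t
    [tuple 1; t; (t ^+ 2 + t + 1) / 2; (t ^+ 3 + t ^+ 2 + t) / 2].
Proof.
move=> dvd1 dvd0; have two0 : (2 : L) != 0 by apply: (intr_neq0 iota (k := 2)).
have t_int := t_integral root_t.
pose p0 := ((1 - a) %/ 2)%Z.
pose q0 := ((a - c) %/ 4)%Z; pose q1 := ((a - b - 1) %/ 4)%Z.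
have p0E : 2 * p0 = 1 - a by lia.
have q0E : 2 ^+ 2 * q0 = a - c by rewrite (_ : 2 ^+ 2 = 4) //; lia.
have q1E : 2 ^+ 2 * q1 = a - b - 1 by rewrite (_ : 2 ^+ 2 = 4) //; lia.
pose y := (t ^+ 2 + t + 1) / 2.
have y_int : integralOver (intr : int -> L) y.
  exact: (@y_integral a b c L iota t root_t 2 p0 1 q0 q1).
have -> : (t ^+ 3 + t ^+ 2 + t) / 2 = t * y by rewrite /y; ring.
rewrite -/y; apply: saturated_basis.
- move=> m; rewrite sum_tuple4 => int_m.
  have [] : qmap intr (m ord0 (inord 0), m ord0 (inord 1), m ord0 (inord 2),
      m ord0 (inord 3)) = 0 :> quad bool.
    apply: (@saturated_unramified a b c L iota t irr_f root_t 2 p0 1 q0 q1) => //.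
    by move: int_m; rewrite /= mulr1.
  move=> /eqP + /eqP + /eqP + /eqP; rewrite -!even_bool => e0 e1 e2 e3.
  by apply: forall_ord4.
- have half : iota 2^-1 = 2^-1 by rewrite fmorphV rmorph_nat.
  apply: forall_ord4; rewrite (tnth_nth 0) /= inordK //=.
  + apply: (@ring_of_integers_cubic L iota t 1 0 0 0); last exact: integral1.
    by rewrite rmorph1 rmorph0; ring.
  + apply: (@ring_of_integers_cubic L iota t 0 1 0 0) => //.
    by rewrite rmorph1 rmorph0; ring.
  + apply: (@ring_of_integers_cubic L iota t 2^-1 2^-1 2^-1 0) => //.
    by rewrite half rmorph0 /y; ring.
  + apply: (@ring_of_integers_cubic L iota t 0 2^-1 2^-1 2^-1).
      by rewrite half rmorph0 /y; ring.
    exact: integral_mul.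
- move=> x /(@ty_span a b c L iota t irr_f root_t 2 isT)[c0 [c1 [c2 [c3 ->]]]].
  exists (\row_i nth 0 [:: c0; c1; c2; c3] i).
  by rewrite /rat_comb sum_tuple4 !mxE !inordK //= mulr1.
- move=> u; rewrite /rat_comb sum_tuple4 mulr1.
  case/(@ty_free a b c L iota t irr_f root_t 2 isT); exact: row4_eq0.
Qed.

End Bases.

Unset Implicit Arguments.

Theorem mainTheorem4 (a b c : int)
    (irr_f : irreducible_poly (map_poly intr (quartic a b c) : {poly rat})) :
  ([/\ (2 %| b)%Z, ~~ (2 %| a)%Z & ~~ (2 %| c)%Z] <->
   exists q : {poly 'F_2}, [/\ irreducible_poly q, size q = 3%N
     & map_poly intr (quartic a b c) = q ^+ 2]) /\
  ((2 %| b)%Z -> ~~ (2 %| a)%Z -> ~~ (2 %| c)%Z ->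
   forall (Qbar : closedFieldType) (iota : {rmorphism rat -> Qbar})
     (theta : Qbar),
   is_algebraic_closure iota ->
   root (map_poly intr (quartic a b c)) theta ->
   (Order.min (v2 (b + 1 - a)) (v2 (c - a)) = 1%:E ->
    is_2integral_basis iota theta
      [tuple 1; theta; theta ^+ 2; theta ^+ 3]) /\
   ((1%:E < Order.min (v2 (b + 1 - a)) (v2 (c - a)))%E ->
    is_2integral_basis iota theta
      [tuple 1; theta; (theta ^+ 2 + theta + 1) / 2;
             (theta ^+ 3 + theta ^+ 2 + theta) / 2])).
Proof.
split; first exact: quartic_square_mod2.
move=> even_b odd_a odd_c Qbar iota theta _ root_theta; split.
  move=> min1; apply: (@power_basis a b c) => //; rewrite negb_and.
  by move: min1; rewrite minEle; case: ifP => _ /v2_eq1 ->; rewrite ?orbT.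
rewrite lt_min => /andP[/v2_gt1 dvd1 /v2_gt1 dvd0].
exact: (@divided_basis a b c).
Qed.
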